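(* Let $1\le p<\infty$ and $0\le\lambda<n$, and let $\beta\in\mathbb R$. If the Hardy–Littlewood maximal operator $M$ on $\mathbb R^n$ is bounded from $\mathcal L^{p,\lambda}(|x|^\beta)$ to $W\mathcal L^{p,\lambda}(|x|^\beta)$, then $\lambda-n\le\beta<\lambda+n(p-1)$.
   Context: $Mf(x)=\sup_{B\ni x}\frac1{|B|}\int_B|f|$, the supremum over Euclidean balls $B\subset\mathbb R^n$ containing $x$. For a nonnegative measurable $w$ and a set $A$, $w(A)=\int_A w$. Morrey norm: $\|f\|_{\mathcal L^{p,\lambda}(w)}=\sup_{x\in\mathbb R^n,\,r>0}\big(\frac1{r^\lambda}\int_{B(x,r)}|f|^p w\big)^{1/p}$, and $\mathcal L^{p,\lambda}(w)$ is the set of measurable $f$ with finite norm. Weak Morrey norm: $\|f\|_{W\mathcal L^{p,\lambda}(w)}=\sup_{x\in\mathbb R^n,\,r>0,\,t>0}\big(\frac{t^p\,w(\{y\in B(x,r):|f(y)|>t\})}{r^\lambda}\big)^{1/p}$, and $W\mathcal L^{p,\lambda}(w)$ is the set of measurable $f$ for which this is finite. Here $B(x,r)$ is the Euclidean ball with center $x$ and radius $r$. Boundedness means that there is $C$ with $\|Mf\|_{W\mathcal L^{p,\lambda}(w)}\le C\|f\|_{\mathcal L^{p,\lambda}(w)}$ for all $f\in\mathcal L^{p,\lambda}(w)$, with $w=|x|^\beta$.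
   Formalization: The case p=1, λ=0, β=0 is excluded: there M is bounded by the classical weak type (1,1) theorem, while the claimed conclusion β<λ+n(p−1) would read 0<0. *)

(* Defs.v *)
From HB Require Import structures.
From mathcomp Require Import all_boot all_order all_algebra.
From mathcomp Require Import all_classical all_reals all_analysis.

Set Implicit Arguments.
Unset Strict Implicit.
Unset Printing Implicit Defensive.

Import Order.TTheory GRing.Theory Num.Theory.

Local Open Scope classical_set_scope.
Local Open Scope ring_scope.
Local Open Scope ereal_scope.

(* Tuples carry the product sigma-algebra, here the Borel sets of R^n. *)
Notation euclid R n := (n.-tuple (measurableTypeR R)).

Section lebesgue_cons.
Context (R : realType) (n : nat).
Variable mu : {sigma_finite_measure set (euclid R n) -> \bar R}.

Definition cons_pair (z : measurableTypeR R * euclid R n) : euclid R n.+1 :=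
  [the n.+1.-tuple _ of z.1 :: z.2].

Lemma measurable_cons_pair : measurable_fun [set: _] cons_pair.
Proof. exact: measurable_cons. Qed.

Definition lebesgue_cons : set (euclid R n.+1) -> \bar R :=
  pushforward (@lebesgue_measure R \x mu) cons_pair.

Let measurable_cons_preimage (A : set (euclid R n.+1)) :
  measurable A -> measurable (cons_pair @^-1` A).
Proof.
by move=> mA; rewrite -[X in measurable X]setTI; exact: measurable_cons_pair.
Qed.

Let lebesgue_cons0 : lebesgue_cons set0 = 0.
Proof. by rewrite /lebesgue_cons /pushforward preimage_set0 measure0. Qed.

Let lebesgue_cons_ge0 A : 0 <= lebesgue_cons A.
Proof. by rewrite /lebesgue_cons /pushforward measure_ge0. Qed.

Let lebesgue_cons_sigma_additive : semi_sigma_additive lebesgue_cons.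
Proof.
move=> F mF tF mUF; rewrite /lebesgue_cons /pushforward preimage_bigcup.
apply: measure_semi_sigma_additive.
- by move=> k; exact: measurable_cons_preimage.
- apply/trivIsetP => /= i j _ _ ij; rewrite -preimage_setI.
  by move/trivIsetP : tF => /(_ _ _ _ _ ij) ->//; rewrite preimage_set0.
- by rewrite -preimage_bigcup; exact: measurable_cons_preimage.
Qed.

HB.instance Definition _ := isMeasure.Build _ _ _ lebesgue_cons
  lebesgue_cons0 lebesgue_cons_ge0 lebesgue_cons_sigma_additive.

Let split_tuple (x : euclid R n.+1) : measurableTypeR R * euclid R n :=
  (tnth x ord0, [tuple of behead x]).

Let cons_pairK : cancel cons_pair split_tuple.
Proof.
by move=> [a x]; rewrite /split_tuple /cons_pair; congr pair; exact: val_inj.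
Qed.

Let measurable_split_tuple : measurable_fun [set: _] split_tuple.
Proof.
apply: measurable_fun_pair; first exact: measurable_tnth.
exact: measurable_behead.
Qed.

Let lebesgue_cons_sigma_finite : sigma_finite [set: _] lebesgue_cons.
Proof.
have /sigma_finiteP[F [TF ndF Foo]] := sigma_finiteT (@lebesgue_measure R).
have /sigma_finiteP[G [TG ndG Goo]] := sigma_finiteT mu.
exists (fun k => split_tuple @^-1` (F k `*` G k)).
  apply/esym; rewrite -subTset => x _.
  have : (\bigcup_k F k) (split_tuple x).1 by rewrite -TF.
  have : (\bigcup_k G k) (split_tuple x).2 by rewrite -TG.
  move=> [j _ Gj] [i _ Fi]; exists (maxn i j) => //; split.
  - by move: Fi; exact/subsetPset/ndF/leq_maxl.
  - by move: Gj; exact/subsetPset/ndG/leq_maxr.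
move=> k; have [mF Fk] := Foo k; have [mG Gk] := Goo k; split.
  rewrite -[X in measurable X]setTI; apply: measurable_split_tuple => //.
  exact: measurableX.
rewrite /lebesgue_cons /pushforward -comp_preimage.
rewrite (_ : split_tuple \o cons_pair = id); last first.
  by apply/funext => z /=; rewrite cons_pairK.
by rewrite preimage_id product_measure1E// lte_mul_pinfty// ge0_fin_numE.
Qed.

HB.instance Definition _ := Measure_isSigmaFinite.Build _ _ _ lebesgue_cons
  lebesgue_cons_sigma_finite.

End lebesgue_cons.

(* n-dimensional Lebesgue measure as an iterated product measure; see
   lebesgue_box for its value on boxes. *)
Fixpoint lebesgue (R : realType) (n : nat) :
    {sigma_finite_measure set (euclid R n) -> \bar R} :=
  match n with
  | 0 => @dirac _ (euclid R 0) [tuple] R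
  | m.+1 => lebesgue_cons (lebesgue R m)
  end.
Arguments lebesgue {R} n.

Lemma measurable_box (R : realType) (n : nat) (A : 'I_n -> set (measurableTypeR R)) :
  (forall i, measurable (A i)) ->
  measurable [set x : euclid R n | forall i, A i (tnth x i)].
Proof.
move=> mA; rewrite (_ : [set _ | _] =
  \bigcap_(i in [set: 'I_n]) ((tnth (T:=measurableTypeR R))^~ i @^-1` A i)).
  apply: fin_bigcap_measurable => // i _.
  by rewrite -[X in measurable X]setTI; apply: (@measurable_tnth _ (measurableTypeR R) n i) => //; exact: mA.
by apply/seteqP; split=> x /= Ax i; [move=> _; exact: Ax|exact: (Ax i I)].
Qed.

Lemma lebesgue_box (R : realType) (n : nat) (A : 'I_n -> set (measurableTypeR R)) :
  (forall i, measurable (A i)) ->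
  lebesgue n [set x | forall i, A i (tnth x i)] =
  \prod_(i < n) lebesgue_measure (A i).
Proof.
elim: n A => [A _|n IHn A mA].
  by rewrite big_ord0 /= diracE mem_set//= => -[].
rewrite big_ord_recl -IHn//= /lebesgue_cons /pushforward.
have tnth_cons (z : measurableTypeR R * euclid R n) i :
    tnth (cons_pair z) (lift ord0 i) = tnth z.2 i.
  by rewrite !(tnth_nth z.1).
rewrite -product_measure1E//; last first.
  by apply: (@measurable_box R n (fun i => A (lift ord0 i))) => i; exact: mA.
congr (product_measure1 _ _ _); apply/seteqP; split=> -[a x] /=.
  move=> Ax; split=> [|i]; first exact: (Ax ord0).
  by have := Ax (lift ord0 i); rewrite tnth_cons.
move=> [Aa Ax] i; case: (unliftP ord0 i) => [j|] -> //.
by rewrite tnth_cons; exact: Ax.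
Qed.

Section morrey.
Context (R : realType) (n : nat).
Implicit Types (x y c : euclid R n) (f w : euclid R n -> R).

Definition enorm x : R := Num.sqrt (\sum_(i < n) (tnth x i : R) ^+ 2)%R.

Definition edist x y : R :=
  Num.sqrt (\sum_(i < n) ((tnth x i : R) - (tnth y i : R)) ^+ 2)%R.

Definition eball c (r : R) : set (euclid R n) := [set y | (edist c y < r)%R].

(* Uncentered: the supremum is over all balls containing x. *)
Definition maximal f x : \bar R :=
  ereal_sup [set m | exists c r, [/\ (0 < r)%R, eball c r x &
    m = (lebesgue n (eball c r))^-1 *
        \int[lebesgue n]_(y in eball c r) `|f y|%:E]].

Definition wmeas w (A : set (euclid R n)) : \bar R :=
  \int[lebesgue n]_(y in A) (w y)%:E.

Definition morrey_norm (p lambda : R) w f : \bar R :=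
  ereal_sup [set m | exists x r, (0 < r)%R /\
    m = ((r `^ lambda)^-1%:E *
         \int[lebesgue n]_(y in eball x r) (`|f y| `^ p * w y)%:E) `^ p^-1].

Definition morrey (p lambda : R) w : set (euclid R n -> R) :=
  [set f | measurable_fun [set: euclid R n] f /\
           morrey_norm p lambda w f < +oo].

(* Stated for extended-real functions, since the maximal function may take the
   value +oo. *)
Definition weak_morrey_norm (p lambda : R) w (g : euclid R n -> \bar R) :
    \bar R :=
  ereal_sup [set m | exists x r t, [/\ (0 < r)%R, (0 < t)%R &
    m = ((t `^ p / r `^ lambda)%:E *
         wmeas w (eball x r `&` [set y | t%:E < `|g y|])) `^ p^-1]].

Definition power_weight (beta : R) : euclid R n -> R :=
  fun x => (enorm x `^ beta)%R.

Definition maximal_bounded (p lambda : R) w : Prop :=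
  exists C : R, forall f, morrey p lambda w f ->
    weak_morrey_norm p lambda w (maximal f) <= C%:E * morrey_norm p lambda w f.

End morrey.

(* Main.v *)
From mathcomp Require Import all_boot all_order all_algebra.
From mathcomp Require Import all_classical all_reals all_analysis.
From mathcomp Require Import measurable_realfun ring lra zify.
Require Import Defs.

(** Both inequalities come from testing the bound on one family of functions,
which approximate [|x|^-n] near the origin.

Write [s_k = 2^-k], and let [Q_s] be the cube of points with all coordinates
in [(s/2, s]].  On [Q_s] the norm is comparable to [s], so the weight
[|x|^beta] is comparable to [s^beta], whatever the sign of [beta].  The cubes
[Q_(s_k)] are pairwise disjoint, and the test function
[f_N = sum_(k < N) s_k^-n 1_(Q_(s_k))] puts the mass [2^-n] on each of them.
They all lie in the ball of radius [n + 1] about the origin, and averaging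
over that ball gives [M f_N >= c N] there ([maximal_spike_ge]): the maximal
function sees the number of scales.  On the other hand the weight of a ball
of radius [r] about the origin is at least [c r^(n + beta)]
([wmeas_eball_ge]).  For [r <= 1] the weak norm of [M f_N] to the power [p]
is thus at least [c N^p r^(n + beta - lambda)].

The Morrey norm of [f_N] is controlled scale by scale, since [Q_s] meets a
ball of radius [rho] in measure at most [(2 min(s, rho))^n].  If
[sum_(k < N) s_k^(beta - n p) min(s_k, rho)^n <= K rho^lambda] for all [rho],
then boundedness of [M] yields [N^p r^(n + beta - lambda) <= A K] with [A]
independent of [N], [K] and [r] ([maximal_bounded_spike]).

For the lower bound on [beta], take [N = 1]: then [K = 1] is allowed, and a
negative exponent [n + beta - lambda] is refuted by letting [r] tend to [0].

For the upper bound, take [r = 1] and suppose that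
[delta = beta - lambda - n (p - 1)] is nonnegative.  Interpolating
[min(s, rho)^n <= s^(n - lambda) rho^lambda] bounds the [k]-th term by
[s_k^delta rho^lambda <= rho^lambda].  So [K = N] always works, and
[N^p <= A N] is absurd when [p > 1].  When [p = 1], a bound [K] independent of
[N] is needed.  If [delta > 0], the terms decay geometrically.  If [delta = 0]
then [lambda > 0], because the triple [p = 1], [lambda = 0], [beta = 0], for
which the maximal operator is of weak type (1,1), is excluded; the terms now
decay geometrically on both sides of the scale [s_k = rho], at the rates
[2^-lambda] and [2^-(n - lambda)] ([dyadic_sum_critical_le]). *)

Set Implicit Arguments.
Unset Strict Implicit.
Unset Printing Implicit Defensive.

Import Order.TTheory GRing.Theory Num.Theory.

Local Open Scope classical_set_scope.
Local Open Scope ring_scope.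

(** * Balls and corner cubes *)

Section geometry.
Context (R : realType) (n : nat).
Implicit Types (x y c : euclid R n) (r s b : R).

Definition origin : euclid R n := [tuple 0 | i < n].

Lemma edist_origin y : edist origin y = enorm y.
Proof.
rewrite /edist /enorm; congr Num.sqrt; apply: eq_bigr => i _.
by rewrite tnth_mktuple sub0r sqrrN.
Qed.

Lemma eball_origin r : eball origin r = [set y | enorm y < r].
Proof. by apply/seteqP; split => y; rewrite /eball /= edist_origin. Qed.

Lemma enorm_ge_coord y i : `|tnth y i : R| <= enorm y.
Proof.
rewrite -sqrtr_sqr /enorm ler_wsqrtr// (bigD1 i)//= lerDl.
by apply: sumr_ge0 => j _; exact: sqr_ge0.
Qed.

Lemma edist_ge_coord c y i : `|(tnth c i : R) - tnth y i| <= edist c y.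
Proof.
rewrite -sqrtr_sqr /edist ler_wsqrtr// (bigD1 i)//= lerDl.
by apply: sumr_ge0 => j _; exact: sqr_ge0.
Qed.

Lemma enorm_le_coord y b : 0 <= b -> (forall i, `|tnth y i : R| <= b) ->
  enorm y <= n%:R * b.
Proof.
move=> b0 yb; rewrite -[leRHS]ger0_norm ?mulr_ge0// -[leRHS]sqrtr_sqr.
rewrite /enorm ler_wsqrtr// exprMn.
apply: (@le_trans _ _ (\sum_(i < n) b ^+ 2)).
  apply: ler_sum => i _; rewrite -real_normK ?num_real//.
  by rewrite lerXn2r ?nnegrE.
rewrite sumr_const card_ord -[leLHS]mulr_natl ler_wpM2r ?sqr_ge0//.
by rewrite -natrX ler_nat; case: (n) => // m; rewrite leq_pmulr.
Qed.

Lemma measurable_enorm : measurable_fun [set: euclid R n] (@enorm R n).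
Proof.
rewrite (_ : @enorm R n =
    (fun x => (\sum_(i < n) (tnth x i : R) ^+ 2) `^ (2^-1))); last first.
  apply/funext => x; rewrite powR12_sqrt//.
  by apply: sumr_ge0 => i _; exact: sqr_ge0.
apply: (measurableT_comp (@measurable_powR R _)).
apply: measurable_sum => i; apply: measurable_funX; exact: measurable_tnth.
Qed.

Lemma measurable_edist c : measurable_fun [set: euclid R n] (edist c).
Proof.
rewrite (_ : edist c =
    (fun x => (\sum_(i < n) ((tnth c i : R) - tnth x i) ^+ 2) `^ (2^-1)));
    last first.
  apply/funext => x; rewrite powR12_sqrt//.
  by apply: sumr_ge0 => i _; exact: sqr_ge0.
apply: (measurableT_comp (@measurable_powR R _)).
apply: measurable_sum => i; apply: measurable_funX; apply: measurable_funB => //.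
exact: measurable_tnth.
Qed.

Lemma measurable_eball c r : measurable (eball c r).
Proof.
rewrite (_ : eball c r = [set: euclid R n] `&` edist c @^-1` `]-oo, r[).
  by apply: measurable_edist => //; exact: measurable_itv.
by rewrite setTI; apply/seteqP; split => y; rewrite /eball/= in_itv.
Qed.

(** The cube [(s/2, s]^n]: its points have norm comparable to [s], and the
cubes for [s = 2^-k] are disjoint, as the first coordinate shows.  It plays
the role of a dyadic annulus, but it is a product of intervals, so that its
measure is explicit. *)
Definition corner s : set (euclid R n) :=
  [set y | forall i, `]s / 2, s]%classic (tnth y i : R)].

Lemma measurable_corner s : measurable (corner s).
Proof.
apply: (@measurable_box R n (fun=> `]s / 2, s]%classic)) => i.
exact: measurable_itv.
Qed.

Lemma lebesgue_corner s : 0 < s -> lebesgue n (corner s) = ((s / 2) ^+ n)%:E.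
Proof.
move=> s0; rewrite /corner (@lebesgue_box R n (fun=> `]s / 2, s]%classic));
  last first.
  by move=> i; exact: measurable_itv.
rewrite (eq_bigr (fun=> (s / 2)%:E)).
  by rewrite prodEFin prodr_const card_ord.
move=> i _; rewrite lebesgue_measure_itv/= lte_fin ifT; last by lra.
by rewrite -EFinB; congr EFin; field.
Qed.

(** The ball sits in the cube of side [2 r] about its center. *)
Lemma lebesgue_eball_le c r : 0 < r ->
  (lebesgue n (eball c r) <= ((2 * r) ^+ n)%:E)%E.
Proof.
move=> r0.
pose A (i : 'I_n) : set (measurableTypeR R) :=
  `](tnth c i : R) - r, (tnth c i : R) + r[%classic.
have mA i : measurable (A i) by exact: measurable_itv.
apply: (@le_trans _ _ (lebesgue n [set x | forall i, A i (tnth x i)])).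
  apply: le_measure; rewrite ?inE.
  - exact: measurable_eball.
  - exact: (@measurable_box R n A).
  - move=> y; rewrite /eball/= => cyr i.
    rewrite /A/= in_itv/=; have := le_lt_trans (edist_ge_coord c y i) cyr.
    by rewrite ltr_norml => /andP[? ?]; apply/andP; split; lra.
rewrite (@lebesgue_box R n A)// (eq_bigr (fun=> (2 * r)%:E)).
  by rewrite prodEFin prodr_const card_ord.
move=> i _; rewrite lebesgue_measure_itv/= lte_fin ifT; last by lra.
by rewrite -EFinB; congr EFin; ring.
Qed.

Lemma corner_le_enorm s y : (0 < n)%N -> 0 < s -> corner s y -> s / 2 <= enorm y.
Proof.
move=> n0 s0 sy; have /= := sy (Ordinal n0); rewrite in_itv/= => /andP[sy0 _].
apply: le_trans (enorm_ge_coord y (Ordinal n0)).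
by apply: le_trans (ler_norm _); exact: ltW.
Qed.

Lemma corner_enorm_le s y : 0 < s -> corner s y -> enorm y <= n%:R * s.
Proof.
move=> s0 sy; apply: enorm_le_coord; first exact: ltW.
move=> i; have /= := sy i; rewrite in_itv/= => /andP[y0 ys].
by rewrite ger0_norm//; lra.
Qed.

Lemma corner_disjoint s t y : (0 < n)%N -> 0 < s -> s <= t / 2 ->
  corner s y -> ~ corner t y.
Proof.
move=> n0 s0 st sy ty.
have /= := sy (Ordinal n0); have /= := ty (Ordinal n0).
by rewrite !in_itv/= => /andP[? ?] /andP[? ?]; lra.
Qed.

End geometry.
Arguments origin {R n}.

(** * Power weights *)

Section weight.
Context (R : realType) (n : nat) (beta : R) (n_gt0 : (0 < n)%N).
Implicit Types (x y c : euclid R n) (r s : R).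

(** The sum covers both signs of [g]: the power is increasing for [g >= 0] and
decreasing for [g <= 0], so that one of the end values dominates. *)
Lemma powR_le_add (a b s g : R) : 0 < a -> a <= s <= b ->
  s `^ g <= a `^ g + b `^ g.
Proof.
move=> a0 /andP[as_ sb]; have s0 : 0 < s by exact: lt_le_trans as_.
have [g0|g0] := leP 0 g.
  apply: (@le_trans _ _ (b `^ g)); last by rewrite lerDr powR_ge0.
  by rewrite ge0_ler_powR ?nnegrE// ltW// (lt_le_trans s0).
apply: (@le_trans _ _ (a `^ g)); last by rewrite lerDl powR_ge0.
rewrite -(opprK g) !(powRN _ (- g)) lef_pV2 ?posrE ?powR_gt0//.
by rewrite ge0_ler_powR ?nnegrE ?oppr_ge0// ltW.
Qed.

(** A bound for [|y|^g / s^g] on [corner s], where [|y| / s] lies between [1/2]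
and [n]. *)
Definition corner_ratio (g : R) : R := 2^-1 `^ g + n%:R `^ g.

Lemma corner_ratio_gt0 g : 0 < corner_ratio g.
Proof. by rewrite addr_gt0// powR_gt0// ltr0n. Qed.

Lemma enorm_powR_le_corner g s y : 0 < s -> corner s y ->
  enorm y `^ g <= corner_ratio g * s `^ g.
Proof.
move=> s0 sy; have s2 : 0 < s / 2 by rewrite divr_gt0.
apply: le_trans (powR_le_add _ s2 _) _.
  by rewrite (corner_le_enorm n_gt0 s0 sy); exact: corner_enorm_le sy.
by rewrite /corner_ratio mulrDl [X in _ <= X + _]mulrC -!powRM ?invr_ge0 ?(ltW s0)//.
Qed.

(** The upper bound for the exponent [- g], inverted. *)
Lemma enorm_powR_ge_corner g s y : 0 < s -> corner s y ->
  (corner_ratio (- g))^-1 * s `^ g <= enorm y `^ g.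
Proof.
move=> s0 sy; have := @enorm_powR_le_corner (- g) _ _ s0 sy.
have y0 : 0 < enorm y.
  by apply: lt_le_trans (corner_le_enorm n_gt0 s0 sy); rewrite divr_gt0.
rewrite !powRN => h; rewrite -lef_pV2 ?posrE ?mulr_gt0 ?invr_gt0 ?powR_gt0//.
  by rewrite invfM invrK.
exact: corner_ratio_gt0.
Qed.

Lemma measurable_power_weight :
  measurable_fun [set: euclid R n] (@power_weight R n beta).
Proof.
by apply: (measurableT_comp (@measurable_powR R _)); exact: measurable_enorm.
Qed.

(** The ball contains the corner cube of size [r / (2 n)], on which the weight
is comparable to [r^beta]; this avoids the singularity of the weight at the
origin. *)
Lemma wmeas_eball_ge : exists2 e : R, 0 < e & forall r, 0 < r ->
  ((e * r `^ (n%:R + beta))%:E <=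
   wmeas (@power_weight R n beta) (eball origin r))%E.
Proof.
have n0 : 0 < n%:R :> R by rewrite ltr0n.
pose a : R := (2 * n%:R)^-1.
have a0 : 0 < a by rewrite invr_gt0 mulr_gt0.
exists ((corner_ratio (- beta))^-1 * a `^ beta * (a / 2) ^+ n).
  by rewrite !mulr_gt0 ?exprn_gt0 ?powR_gt0 ?invr_gt0 ?corner_ratio_gt0 ?mulr_gt0.
move=> r r0; have ar0 : 0 < a * r by rewrite mulr_gt0.
have sub : corner (a * r) `<=` eball (origin : euclid R n) r.
  move=> y ay; rewrite eball_origin/=.
  apply: le_lt_trans (corner_enorm_le ar0 ay) _.
  rewrite /a invfM mulrA mulrCA mulfV ?gt_eqF// mulr1; lra.
apply: (@le_trans _ _ (\int[lebesgue n]_(y in corner (a * r))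
    (power_weight beta y)%:E)%E); last first.
  apply: ge0_subset_integral => //; [exact: measurable_corner|
    exact: measurable_eball| |].
  - apply/measurable_EFinP; apply: measurable_funS measurable_power_weight => //.
  - by move=> y _; rewrite lee_fin powR_ge0.
pose v : R := (corner_ratio (- beta))^-1 * (a * r) `^ beta.
have v0 : 0 <= v by rewrite mulr_ge0 ?powR_ge0 ?invr_ge0 ?ltW ?corner_ratio_gt0.
apply: (@le_trans _ _ (\int[lebesgue n]_(y in corner (a * r)) (cst v%:E y))%E).
  rewrite integral_cst; last exact: measurable_corner.
  rewrite [X in (_ <= _ * X)%E](lebesgue_corner n ar0).
  rewrite -EFinM lee_fin /v powRM ?(ltW a0) ?(ltW r0)//.
  rewrite powRD ?(gt_eqF r0) ?implybT// powR_mulrn ?(ltW r0)//.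
  by rewrite !exprMn le_eqVlt; apply/orP; left; apply/eqP; ring.
apply: ge0_le_integral => //.
- exact: measurable_corner.
- apply/measurable_EFinP; apply: measurable_funS measurable_power_weight => //.
- by move=> y ay; rewrite lee_fin; exact: enorm_powR_ge_corner.
Qed.

End weight.

(** * The test functions *)

Section spikes.
Context (R : realType) (n : nat) (n_gt0 : (0 < n)%N).
Implicit Types (x y c : euclid R n) (r s : R).

Definition dyadic k : R := 2^-1 ^+ k.

Lemma dyadic_gt0 k : 0 < dyadic k.
Proof. by rewrite exprn_gt0. Qed.

Lemma dyadic_ge0 k : 0 <= dyadic k.
Proof. exact/ltW/dyadic_gt0. Qed.

Lemma dyadic_le1 k : dyadic k <= 1.
Proof. by rewrite exprn_ile1// invf_le1// ler1n. Qed.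

(** A discretization of [|y|^-n], truncated below the scale [2^-N]; each
scale carries the same mass [2^-n]. *)
Definition spike (N : nat) y : R :=
  \sum_(k < N) (dyadic k ^- n * \1_(corner (dyadic k)) y).

Lemma dyadic_corner_disjoint j k y : j != k ->
  corner (dyadic k) y -> ~ corner (dyadic j) y.
Proof.
have H i l (z : euclid R n) : (i < l)%N ->
    corner (dyadic l) z -> ~ corner (dyadic i) z.
  move=> il; apply: corner_disjoint (dyadic_gt0 l) _ => //.
  rewrite /dyadic -exprSr; apply: ler_wiXn2l => //.
  by rewrite invf_le1// ler1n.
case: ltngtP => // jk _; first exact: H.
by move=> ky jy; exact: (H _ _ _ jk jy ky).
Qed.

Lemma spikeE N (k : 'I_N) y : corner (dyadic k) y -> spike N y = dyadic k ^- n.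
Proof.
move=> ky; rewrite /spike (bigD1 k)//= big1 ?addr0 => [|j jk].
  by rewrite indicE mem_set// mulr1.
rewrite indicE memNset ?mulr0//; exact: dyadic_corner_disjoint ky.
Qed.

Lemma spike_ge0 N y : 0 <= spike N y.
Proof.
apply: sumr_ge0 => k _.
by rewrite mulr_ge0 ?invr_ge0 ?exprn_ge0 ?dyadic_ge0.
Qed.

Lemma measurable_spike N : measurable_fun [set: euclid R n] (spike N).
Proof.
apply: measurable_sum => k; apply: measurable_funM => //.
by apply: measurable_indic; exact: measurable_corner.
Qed.

Lemma integral_sum_corner (D : set (euclid R n)) N (a : 'I_N -> R) :
  measurable D -> (forall k, 0 <= a k) ->
  (\int[lebesgue n]_(y in D)
     (\sum_(k < N) (a k * \1_(corner (dyadic k)) y))%:E =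
   \sum_(k < N) (a k)%:E * lebesgue n (corner (dyadic k) `&` D))%E.
Proof.
move=> mD a0; under eq_integral do rewrite -sumEFin.
rewrite ge0_integral_sum//; last 2 first.
- move=> k; apply/measurable_EFinP; apply: measurable_funM => //.
  by apply: measurable_indic; exact: measurable_corner.
- by move=> k y _; rewrite lee_fin mulr_ge0.
apply: eq_bigr => k _; under eq_integral do rewrite EFinM.
rewrite ge0_integralZl ?lee_fin//.
- by rewrite integral_indic//; exact: measurable_corner.
- by apply/measurable_EFinP; apply: measurable_indic; exact: measurable_corner.
Qed.

(** All the cubes lie in the ball of radius [n + 1] about the origin, so that
the average of the spike over this ball is [N 2^-n] divided by its measure. *)
Lemma maximal_spike_ge : exists2 e : R, 0 < e & forall N x,
  enorm x < n%:R + 1 -> ((e * N%:R)%:E <= maximal (spike N) x)%E.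
Proof.
pose r : R := n%:R + 1.
have r0 : 0 < r by rewrite ltr_wpDl.
have d0 : 0 < (2 * r) ^+ n by rewrite exprn_gt0// mulr_gt0.
exists (((2 * r) ^+ n)^-1 * 2^-1 ^+ n).
  by rewrite mulr_gt0 ?invr_gt0// exprn_gt0.
move=> N x xr; apply: ereal_sup_ge.
pose B : set (euclid R n) := eball origin r.
exists ((lebesgue n B)^-1 * \int[lebesgue n]_(y in B) `|spike N y|%:E)%E.
  by exists origin, r; split => //; rewrite eball_origin.
have mB : measurable B by exact: measurable_eball.
have -> : (\int[lebesgue n]_(y in B) `|spike N y|%:E =
    (N%:R * 2^-1 ^+ n)%:E)%E.
  under eq_integral do rewrite (ger0_norm (spike_ge0 _ _)).
  rewrite /spike integral_sum_corner//; last first.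
    by move=> k; rewrite invr_ge0 exprn_ge0// dyadic_ge0.
  rewrite (eq_bigr (fun=> (2^-1 ^+ n)%:E)); last first.
    move=> k _; rewrite setIidl; last first.
      move=> y ky; rewrite /B eball_origin/=.
      apply: le_lt_trans (corner_enorm_le (dyadic_gt0 k) ky) _.
      by rewrite /r (@le_lt_trans _ _ n%:R) ?ltrDl// ler_piMr// dyadic_le1.
    rewrite (lebesgue_corner n (dyadic_gt0 k)) -EFinM; congr EFin.
    by rewrite expr_div_n exprVn mulrA mulVf ?mul1r// expf_neq0// gt_eqF ?dyadic_gt0.
  by rewrite sumEFin sumr_const card_ord mulr_natl.
rewrite -mulrA EFinM (mulrC N%:R); apply: lee_wpmul2r.
  by rewrite lee_fin mulr_ge0// exprn_ge0.
rewrite (_ : ((2 * r) ^- n)%:E = (((2 * r) ^+ n)%:E)^-1%E); last first.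
  by rewrite inver gt_eqF.
by rewrite lee_pV2 ?inE ?lee_fin ?(ltW d0)//; exact: lebesgue_eball_le.
Qed.

(** The intersection is no larger than the cube, nor than the cube of side
[2 r] around the ball. *)
Lemma lebesgue_corner_eball_le s x r : 0 < s -> 0 < r ->
  (lebesgue n (corner s `&` eball x r) <= ((2 * Num.min s r) ^+ n)%:E)%E.
Proof.
move=> s0 r0; rewrite minEle; case: ifPn => _.
  apply: (@le_trans _ _ (lebesgue n (corner s))).
    apply: le_measure; rewrite ?inE; [apply: measurableI| |by move=> ? []].
    - exact: measurable_corner.
    - exact: measurable_eball.
    - exact: measurable_corner.
  rewrite lebesgue_corner// lee_fin lerXn2r ?nnegrE//; lra.
apply: le_trans (lebesgue_eball_le x r0).
apply: le_measure; rewrite ?inE; [apply: measurableI| |by move=> ? []].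
- exact: measurable_corner.
- exact: measurable_eball.
- exact: measurable_eball.
Qed.

(** Disjointness of the cubes lets the power [p] act on each term separately. *)
Lemma spike_powR_weight_le (p beta : R) N y : 0 < p ->
  spike N y `^ p * power_weight beta y <=
  \sum_(k < N) (corner_ratio n beta * dyadic k `^ (beta - n%:R * p) *
                \1_(corner (dyadic k)) y).
Proof.
move=> p0; have t0 (k : 'I_N) : 0 <= corner_ratio n beta *
    dyadic k `^ (beta - n%:R * p) * \1_(corner (dyadic k)) y.
  by rewrite !mulr_ge0 ?powR_ge0// ltW ?corner_ratio_gt0.
have [[k ky]|noy] := pselect (exists k : 'I_N, corner (dyadic k) y).
  rewrite (spikeE ky) (bigD1 k)//= indicE mem_set// mulr1.
  apply: ler_wpDr; first by apply: sumr_ge0 => j _; exact: t0.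
  rewrite -powR_invn ?dyadic_ge0// -powRrM mulNr addrC.
  rewrite powRD ?(gt_eqF (dyadic_gt0 _)) ?implybT// mulrCA ler_wpM2l ?powR_ge0//.
  exact: enorm_powR_le_corner (dyadic_gt0 k) ky.
rewrite [spike N y]big1 ?powR0 ?mul0r ?gt_eqF//; first by apply: sumr_ge0.
move=> k _; rewrite indicE memNset ?mulr0// => ky; apply: noy; by exists k.
Qed.

Lemma morrey_integral_spike_le (p beta : R) N x r : 0 < p -> 0 < r ->
  (\int[lebesgue n]_(y in eball x r)
     (`|spike N y| `^ p * power_weight beta y)%:E <=
   (2 ^+ n * corner_ratio n beta * \sum_(k < N)
     (dyadic k `^ (beta - n%:R * p) * Num.min (dyadic k) r ^+ n))%:E)%E.
Proof.
move=> p0 r0.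
pose a (k : 'I_N) : R := corner_ratio n beta * dyadic k `^ (beta - n%:R * p).
have a0 k : 0 <= a k by rewrite mulr_ge0 ?powR_ge0// ltW ?corner_ratio_gt0.
apply: (@le_trans _ _ (\int[lebesgue n]_(y in eball x r)
    (\sum_(k < N) (a k * \1_(corner (dyadic k)) y))%:E)%E).
  apply: ge0_le_integral => //.
  - exact: measurable_eball.
  - by move=> y _; rewrite lee_fin mulr_ge0 ?powR_ge0.
  - apply/measurable_EFinP; apply: measurable_funS (measurableT) _ _ => //.
    apply: measurable_funM; last exact: measurable_power_weight.
    apply: (measurableT_comp (@measurable_powR R _)).
    by apply: measurableT_comp => //; exact: measurable_spike.
  - apply/measurable_EFinP; apply: measurable_sum => k; apply: measurable_funM => //.
    by apply: measurable_indic; exact: measurable_corner.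
  - move=> y _; rewrite lee_fin ger0_norm ?spike_ge0//.
    exact: spike_powR_weight_le.
rewrite integral_sum_corner//; last exact: measurable_eball.
rewrite mulr_sumr -sumEFin; apply: lee_sum => k _.
apply: (@le_trans _ _ ((a k)%:E * ((2 * Num.min (dyadic k) r) ^+ n)%:E)%E).
  by rewrite lee_wpmul2l ?lee_fin// lebesgue_corner_eball_le ?dyadic_gt0.
rewrite -EFinM lee_fin /a exprMn.
by rewrite le_eqVlt; apply/orP; left; apply/eqP; ring.
Qed.

End spikes.

(** * Sums over dyadic scales *)

Section sums.
Context (R : realType) (n : nat).
Implicit Types (x y a r s : R).

Lemma geometric_sum_le x N : 0 <= x < 1 -> \sum_(k < N) x ^+ k <= (1 - x)^-1.
Proof.
move=> /andP[x0 x1]; rewrite -[leRHS]div1r ler_pdivlMr ?subr_gt0// mulrC.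
rewrite -opprB mulNr -subrX1 opprB.
by rewrite lerBlDr lerDl exprn_ge0.
Qed.

(** A geometric decay on either side of the index [M], with the largest terms
at [M - 1] and [M]. *)
Lemma two_sided_geometric_sum_le x y M N : 0 <= x < 1 -> 0 <= y < 1 ->
  \sum_(k < N) (if (M <= k)%N then x ^+ (k - M) else y ^+ (M.-1 - k)) <=
  (1 - y)^-1 + (1 - x)^-1.
Proof.
move=> x01 y01; have [[x0 _] [y0 _]] := (andP x01, andP y01).
pose g k : R := if (M <= k)%N then x ^+ (k - M) else y ^+ (M.-1 - k).
have g0 k : 0 <= g k by rewrite /g; case: ifP => _; rewrite exprn_ge0.
apply: (@le_trans _ _ (\sum_(k < M + N) g k)).
  rewrite addnC big_split_ord/=; apply: ler_wpDr => //.
  by apply: sumr_ge0.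
rewrite big_split_ord/=; apply: lerD.
  apply: le_trans (geometric_sum_le M y01).
  rewrite (reindex_inj rev_ord_inj)/=; apply: ler_sum => k _.
  rewrite /g ifF; last by apply/negbTE; have := ltn_ord k; lia.
  by rewrite (_ : (M.-1 - (M - k.+1))%N = k)//; have := ltn_ord k; lia.
apply: le_trans (geometric_sum_le N x01).
by apply: ler_sum => k _; rewrite /g leq_addr addKn.
Qed.

Lemma dyadic_powR k a : dyadic R k `^ a = (2^-1 `^ a) ^+ k.
Proof.
by rewrite -[RHS]powR_mulrn ?powR_ge0// powRAC powR_mulrn ?invr_ge0.
Qed.

Lemma half_powR_lt1 a : 0 < a -> 0 <= (2^-1 : R) `^ a < 1.
Proof.
move=> a0; rewrite powR_ge0/= -[ltRHS](congr1 (@^~ a) (powR1 R)).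
rewrite gt0_ltr_powR ?nnegrE ?invr_ge0// invf_lt1// ltr1n//.
Qed.

Lemma dyadic_small r : 0 < r -> exists k, dyadic R k <= r.
Proof.
move=> r0; exists (Num.truncn r^-1).+1.
rewrite /dyadic exprVn -[leRHS]invrK lef_pV2 ?posrE ?exprn_gt0 ?invr_gt0//.
apply: le_trans (ltW (truncnS_gt _)) _.
by rewrite -natrX ler_nat ltnW// ltn_expl.
Qed.

(** Interpolation: [min(s, r)^n] is split as a power [n - lambda] and a power
[lambda], and the minimum is bounded by [s] in the first and by [r] in the
second. *)
Lemma min_exprn_le lambda s r : 0 <= lambda <= n%:R -> 0 < s -> 0 < r ->
  Num.min s r ^+ n <= s `^ (n%:R - lambda) * r `^ lambda.
Proof.
move=> /andP[l0 ln] s0 r0; set m := Num.min s r.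
have m0 : 0 < m by rewrite lt_min s0.
rewrite -powR_mulrn ?(ltW m0)// -[in leLHS](subrK lambda n%:R).
rewrite powRD ?(gt_eqF m0) ?implybT//.
by apply: ler_pM; rewrite ?powR_ge0// ge0_ler_powR ?nnegrE ?subr_ge0//
  ?(ltW m0) ?(ltW s0) ?(ltW r0)//; rewrite ge_min lexx ?orbT.
Qed.

(** Interpolation gives up the decay of the terms at scales far from [r]; the
right-hand side still stays bounded in [N] as long as the ratio
[2^-(a + n - lambda)] is less than [1]. *)
Lemma dyadic_sum_le (lambda a : R) N r : 0 <= lambda <= n%:R -> 0 < r ->
  \sum_(k < N) (dyadic R k `^ a * Num.min (dyadic R k) r ^+ n) <=
  (\sum_(k < N) (2^-1 `^ (a + (n%:R - lambda))) ^+ k) * r `^ lambda.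
Proof.
move=> ln r0; rewrite mulr_suml; apply: ler_sum => k _.
rewrite -dyadic_powR powRD ?(gt_eqF (dyadic_gt0 _ _)) ?implybT// -mulrA.
by rewrite ler_wpM2l ?powR_ge0// min_exprn_le ?dyadic_gt0.
Qed.

(** At the exponent where interpolation bounds every term by [r^lambda] only,
the terms are [s^lambda] for the scales [s <= r] and
[s^-(n - lambda) r^n] for the scales [s > r], and both families are geometric
with their largest terms next to [r]. *)
Lemma dyadic_sum_critical_le (lambda : R) N r : 0 < lambda < n%:R -> 0 < r ->
  \sum_(k < N) (dyadic R k `^ (lambda - n%:R) * Num.min (dyadic R k) r ^+ n) <=
  ((1 - 2^-1 `^ (n%:R - lambda))^-1 + (1 - 2^-1 `^ lambda)^-1) * r `^ lambda.
Proof.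
move=> /andP[l0 ln] r0.
have d0 := dyadic_gt0 R.
(* [2^-M] is the first dyadic scale below [r]. *)
case: (ex_minnP (dyadic_small r0)) => M Mr Mmin.
have nl0 : 0 < n%:R - lambda by rewrite subr_gt0.
apply: le_trans; last first.
  apply: ler_wpM2r; first exact: powR_ge0.
  exact: (two_sided_geometric_sum_le M N (half_powR_lt1 l0) (half_powR_lt1 nl0)).
rewrite mulr_suml; apply: ler_sum => k _; case: ifPn => [Mk|].
  apply: (@le_trans _ _ (dyadic R k `^ lambda)).
    rewrite -[X in _ <= _ `^ X](subrK n%:R).
    rewrite [in leRHS]powRD ?(gt_eqF (d0 _)) ?implybT//.
    rewrite powR_mulrn ?(ltW (d0 _))// ler_wpM2l ?powR_ge0//.
    rewrite lerXn2r ?nnegrE ?(ltW (d0 _))//.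
      by rewrite le_min !ltW.
    by rewrite ge_min lexx.
  rewrite -dyadic_powR -powRM ?dyadic_ge0 ?(ltW r0)//.
  rewrite ge0_ler_powR ?nnegrE ?mulr_ge0 ?dyadic_ge0 ?(ltW r0) ?(ltW l0)//.
  by rewrite -[in leLHS](subnK Mk) /dyadic exprD ler_wpM2l ?exprn_ge0.
rewrite -ltnNge => kM.
apply: (@le_trans _ _ (dyadic R k `^ (lambda - n%:R) * r ^+ n)).
  rewrite ler_wpM2l ?powR_ge0// lerXn2r ?nnegrE ?(ltW r0)//.
    by rewrite le_min !ltW.
  by rewrite ge_min lexx orbT.
have -> : r ^+ n = r `^ (n%:R - lambda) * r `^ lambda.
  by rewrite -powRD ?(gt_eqF r0) ?implybT// subrK powR_mulrn ?ltW.
rewrite mulrA ler_wpM2r ?powR_ge0// -opprB powRN mulrC ler_pdivrMr ?powR_gt0//.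
rewrite -dyadic_powR -powRM ?dyadic_ge0 ?(ltW r0)//.
rewrite ge0_ler_powR ?nnegrE ?mulr_ge0 ?dyadic_ge0 ?(ltW r0) ?(ltW nl0)//.
rewrite /dyadic -exprD subnK; last by lia.
rewrite leNgt; apply/negP => /ltW /Mmin; lia.
Qed.

End sums.

(** * Consequences of boundedness *)

Section consequences.
Context (R : realType) (n : nat) (p lambda beta : R).
Context (n_gt0 : (0 < n)%N) (p_gt0 : 0 < p).
Implicit Types (x : euclid R n) (r : R).

Lemma morrey_norm_le (w f : euclid R n -> R) (K : R) :
  (forall y, 0 <= w y) ->
  (forall x r, 0 < r -> (\int[lebesgue n]_(y in eball x r)
     (`|f y| `^ p * w y)%:E <= (K * r `^ lambda)%:E)%E) ->
  (morrey_norm p lambda w f <= (K `^ p^-1)%:E)%E.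
Proof.
move=> w0 fK; apply: ge_ereal_sup => _ [x [r [r0 ->]]].
have rl : 0 < r `^ lambda by exact: powR_gt0.
have I0 : (0 <= \int[lebesgue n]_(y in eball x r) (`|f y| `^ p * w y)%:E)%E.
  by apply: integral_ge0 => y _; rewrite lee_fin mulr_ge0 ?powR_ge0.
have IK : ((r `^ lambda)^-1%:E *
    \int[lebesgue n]_(y in eball x r) (`|f y| `^ p * w y)%:E <= K%:E)%E.
  apply: le_trans (lee_wpmul2l _ (fK x r r0)) _.
    by rewrite lee_fin invr_ge0 ltW.
  by rewrite -EFinM lee_fin mulrCA mulVf ?mulr1// gt_eqF.
have J0 : (0 <= (r `^ lambda)^-1%:E *
    \int[lebesgue n]_(y in eball x r) (`|f y| `^ p * w y)%:E)%E.
  by rewrite mule_ge0// lee_fin invr_ge0 ltW.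
have K0 := le_trans J0 IK.
rewrite -poweR_EFin; apply: gt0_ler_poweR IK.
- by rewrite invr_ge0 ltW.
- by rewrite in_itv/= J0 leey.
- by rewrite in_itv/= K0 leey.
Qed.

Lemma morrey_norm_ge0 (w f : euclid R n -> R) : (0 <= morrey_norm p lambda w f)%E.
Proof.
apply: le_trans (poweR_ge0 _ _) _; last first.
  by apply: ereal_sup_ubound; exists origin, 1; split.
Qed.

(** The constant [A] gathers the operator norm and the geometric constants.
The level [t] of the weak norm is half the lower bound for the maximal
function, so that the level set contains the whole ball. *)
Lemma maximal_bounded_spike :
  maximal_bounded p lambda (@power_weight R n beta) ->
  exists A : R, forall N K r, 0 <= K -> 0 < r <= 1 ->
    (forall rho, 0 < rho ->
      \sum_(k < N) (dyadic R k `^ (beta - n%:R * p) *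
                    Num.min (dyadic R k) rho ^+ n) <= K * rho `^ lambda) ->
    N%:R `^ p * r `^ (n%:R + beta - lambda) <= A * K.
Proof.
move=> [C HC].
have [e e0 we] := @wmeas_eball_ge R n beta n_gt0.
have [m m0 Mm] := @maximal_spike_ge R n.
have D0 : 0 < 2 ^+ n * corner_ratio n beta.
  by rewrite mulr_gt0 ?exprn_gt0 ?corner_ratio_gt0.
set D := 2 ^+ n * corner_ratio n beta in D0.
have c0 : 0 < (m / 2) `^ p * e by rewrite mulr_gt0 ?powR_gt0// divr_gt0.
exists (`|C| `^ p * D / ((m / 2) `^ p * e)) => N K r K0 /andP[r0 r1] NK.
have [->|N0] := posnP N.
  rewrite powR0 ?gt_eqF// mul0r mulr_ge0// divr_ge0 ?(ltW c0)//.
  by rewrite mulr_ge0 ?powR_ge0 ?(ltW D0).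
pose f : euclid R n -> R := spike N.
have fK x rho : 0 < rho -> (\int[lebesgue n]_(y in eball x rho)
    (`|f y| `^ p * power_weight beta y)%:E <= ((D * K) * rho `^ lambda)%:E)%E.
  move=> rho0.
  apply: le_trans (morrey_integral_spike_le n_gt0 beta N x p_gt0 rho0) _.
  by rewrite lee_fin -[leRHS]mulrA ler_wpM2l ?(ltW D0)// NK.
have fn := morrey_norm_le (fun y => powR_ge0 (enorm y) beta) fK.
have Mf : morrey p lambda (power_weight beta) f.
  split; first exact: measurable_spike.
  by apply: le_lt_trans fn _; rewrite ltry.
have H : (weak_morrey_norm p lambda (power_weight beta) (maximal f) <=
    (`|C| * (D * K) `^ p^-1)%:E)%E.
  apply: le_trans (HC _ Mf) _; rewrite EFinM.
  apply: (@le_trans _ _ (`|C|%:E * morrey_norm p lambda (power_weight beta) f)%E).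
    by rewrite lee_wpmul2r ?morrey_norm_ge0// lee_fin ler_norm.
  by rewrite lee_wpmul2l// lee_fin.
pose t : R := m / 2 * N%:R.
have t0 : 0 < t by rewrite !mulr_gt0 ?invr_gt0// ltr0n.
have tp : 0 < t `^ p / r `^ lambda by rewrite divr_gt0// powR_gt0.
have X0 : 0 <= t `^ p / r `^ lambda * (e * r `^ (n%:R + beta)).
  by rewrite !mulr_ge0 ?powR_ge0 ?invr_ge0 ?powR_ge0// ltW.
set X : R := t `^ p / r `^ lambda * (e * r `^ (n%:R + beta)) in X0.
have HX : ((X `^ p^-1)%:E <= (`|C| * (D * K) `^ p^-1)%:E)%E.
  apply: le_trans _ H; apply: le_trans; last first.
    by apply: ereal_sup_ubound; exists origin, r, t; split.
  rewrite -poweR_EFin; apply: gt0_ler_poweR.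
  - by rewrite invr_ge0 ltW.
  - by rewrite in_itv/= lee_fin X0 leey.
  - rewrite in_itv/= leey andbT mule_ge0 ?lee_fin ?(ltW tp)//.
    by apply: integral_ge0 => y _; rewrite lee_fin powR_ge0.
  - rewrite setIidl; last first.
      move=> y; rewrite eball_origin/= => yr.
      apply: (@lt_le_trans _ _ (m * N%:R)%:E).
        by rewrite lte_fin /t ltr_pM2r ?ltr0n//; lra.
      apply: le_trans (lee_abs _); apply: Mm.
      by apply: lt_le_trans yr _; rewrite (le_trans r1)// lerDr.
    by rewrite /X EFinM lee_wpmul2l ?lee_fin ?(ltW tp)//; exact: we.
have {HX} : X <= `|C| `^ p * (D * K).
  have pK (z : R) : 0 <= z -> (z `^ p^-1) `^ p = z.
    by move=> z0; rewrite -powRrM mulVf ?gt_eqF// powRr1.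
  have DK0 : 0 <= D * K by rewrite mulr_ge0// ltW.
  rewrite -[X]pK// -[D * K]pK// -powRM ?powR_ge0//.
  by rewrite ge0_ler_powR ?nnegrE ?mulr_ge0 ?powR_ge0 ?(ltW p_gt0)// -lee_fin.
rewrite [_ / _ * K]mulrAC ler_pdivlMr// -[_ * D * K]mulrA.
apply: le_trans; rewrite /X /t (@powRM _ (m / 2)) ?divr_ge0 ?(ltW m0)//.
rewrite powRB ?(gt_eqF r0) ?implybT//.
by rewrite le_eqVlt; apply/orP; left; apply/eqP; ring.
Qed.

End consequences.

(** * The range of exponents *)

Theorem proposition5p3 (R : realType) (n : nat) (p lambda beta : R)
  (hp : 1 <= p) (hlambda0 : 0 <= lambda) (hlambdan : lambda < n%:R)
  (hexc : ~ (p = 1 /\ lambda = 0 /\ beta = 0))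
  (hM : @maximal_bounded R n p lambda (@power_weight R n beta)) :
  lambda - n%:R <= beta /\ beta < lambda + n%:R * (p - 1).
Proof.
have n0 : (0 < n)%N by rewrite -(ltr0n R); exact: le_lt_trans hlambdan.
have p0 : 0 < p by exact: lt_le_trans hp.
have ln : 0 <= lambda <= n%:R by rewrite hlambda0 ltW.
have [A HA] := maximal_bounded_spike n0 p0 hM.
split.
  rewrite leNgt; apply/negP => bl.
  pose g : R := n%:R + beta - lambda.
  have g0 : g < 0 by rewrite /g; lra.
  (* The radius at which [r ^ g] equals [|A| + 1]. *)
  pose r : R := (`|A| + 1) `^ g^-1.
  have r01 : 0 < r <= 1.
    have A1 : 0 < `|A| + 1 by rewrite ltr_wpDl.
    rewrite powR_gt0//= /r -[leRHS](powRr0 (`|A| + 1)) ler_powR ?lerDr//.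
    by rewrite invr_le0 ltW.
  have := HA 1%N 1 r ler01 r01; rewrite powR1 mul1r mulr1 -powRrM mulVf ?lt_eqF//.
  rewrite powRr1 ?addr_ge0// => H.
  suff /H : forall rho, 0 < rho -> \sum_(k < 1) (dyadic R k `^ (beta - n%:R * p) *
      Num.min (dyadic R k) rho ^+ n) <= 1 * rho `^ lambda.
    by have := ler_norm A; lra.
  move=> rho rho0; apply: le_trans (dyadic_sum_le _ _ ln rho0) _.
  by rewrite big_ord1 expr0.
rewrite ltNge; apply/negP => bl.
have dl : 0 <= beta - n%:R * p + (n%:R - lambda) by lra.
have HN N K : 0 <= K -> (forall rho, 0 < rho ->
    \sum_(k < N) (dyadic R k `^ (beta - n%:R * p) *
      Num.min (dyadic R k) rho ^+ n) <= K * rho `^ lambda) ->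
    N%:R `^ p <= A * K.
  move=> K0 NK; have := HA N K 1 K0 _ NK.
  by rewrite powR1 mulr1 => -> //; rewrite ltr01 lexx.
have [p1|p1] := eqVneq p 1.
  have [K K0 NK] : exists2 K, 0 <= K & forall N rho, 0 < rho ->
      \sum_(k < N) (dyadic R k `^ (beta - n%:R * p) *
        Num.min (dyadic R k) rho ^+ n) <= K * rho `^ lambda.
    move: dl; rewrite le_eqVlt => /predU1P[dl|dl].
      have bE : beta - n%:R * p = lambda - n%:R by lra.
      have l0 : 0 < lambda.
        rewrite lt_neqAle hlambda0 andbT; apply/eqP => l0.
        apply: hexc; split => //; split => //; move: dl; rewrite p1 -l0; lra.
      rewrite bE; eexists; last first.
        by move=> N rho rho0; apply: dyadic_sum_critical_le; rewrite ?l0.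
      have /andP[_ h1] := half_powR_lt1 l0.
      have nl : 0 < n%:R - lambda by rewrite subr_gt0.
      have /andP[_ h2] := half_powR_lt1 nl.
      by rewrite addr_ge0// invr_ge0 subr_ge0 ltW.
    have hd := half_powR_lt1 dl; eexists; last first.
      move=> N rho rho0; apply: le_trans (dyadic_sum_le _ _ ln rho0) _.
      apply: ler_wpM2r; first exact: powR_ge0.
      exact: geometric_sum_le hd.
    by rewrite invr_ge0 subr_ge0 ltW//; case/andP: hd.
  have := HN (Num.truncn (A * K)).+1 K K0 (NK _).
  by rewrite p1 powRr1// leNgt truncnS_gt.
have pp : 0 < p - 1 by rewrite subr_gt0 lt_neqAle eq_sym p1.
(* This many scales make [N ^ (p - 1)] exceed [|A| + 1]. *)
pose N := (Num.truncn ((`|A| + 1) `^ (p - 1)^-1)).+1.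
have N0 : 0 < N%:R :> R by rewrite ltr0n.
have : N%:R `^ p <= A * N%:R.
  apply: HN => // rho rho0; apply: le_trans (dyadic_sum_le _ _ ln rho0) _.
  apply: ler_wpM2r; first exact: powR_ge0.
  rewrite -[X in _ <= X%:R]card_ord -sumr_const; apply: ler_sum => k _.
  rewrite exprn_ile1 ?powR_ge0//.
  rewrite -[leRHS](congr1 (@^~ (beta - n%:R * p + (n%:R - lambda))) (powR1 R)).
  by rewrite ge0_ler_powR ?nnegrE ?invr_ge0// invf_le1// ler1n.
rewrite -(mulr_powRB1 (ltW N0) p0) mulrC ler_pM2r//; apply/negP; rewrite -ltNge.
apply: (@lt_trans _ _ (`|A| + 1)); first by have := ler_norm A; lra.
have <- : ((`|A| + 1) `^ (p - 1)^-1) `^ (p - 1) = `|A| + 1.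
  by rewrite -powRrM mulVf ?gt_eqF// powRr1// addr_ge0.
by rewrite gt0_ltr_powR ?nnegrE ?powR_ge0// truncnS_gt.
Qed.
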